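(* Assume that $(G,Z,\delta)$ is a new setup, and let $R=\mathrm{Rad}\,\delta$, $N=G'R$. There exists a mapping $\mu:G/R\times G/R\to Z$ satisfying (writing $\mu(x,y)$ for $\mu(xR,yR)$) (A1) $\delta(x,y)=\mu(x,y)\mu(y,x)^{-1}$ for all $x,y\in G$, (A2) $\mu(xy,z)=\mu(x,z)\mu(y,z)$ whenever $x,y,z\in G$ and $\{x,y,z\}\cap N\neq\emptyset$, (A3) $\mu(x,yz)=\mu(x,y)\mu(x,z)$ whenever $x,y,z\in G$ and $\{x,y,z\}\cap N\neq\emptyset$. For every such $\mu$, the tuple $(G,Z,R,N,\mu,\delta)$ is an original setup. In particular, for the loop $Q=G[\mu]$ we have $\mathrm{cl}(G)\le 3$, $\mathrm{cl}(Q)\le 3$, and $\mathrm{Inn}\,Q$ is abelian. Moreover, $\mathrm{cl}(Q)=3$ if and only if $$\delta([x,y],z)\,\delta([y,z],x)\,\delta([z,x],y)\neq 1\quad\text{for some }x,y,z\in G.$$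
   Context: Conventions: $x^y=y^{-1}xy$, $[x,y]=x^{-1}y^{-1}xy$; $G'$ is the derived subgroup, $Z(G)$ the center. A new setup $(G,Z,\delta)$ consists of a group $G$, a subgroup $Z\le Z(G)$ and a mapping $\delta:G/Z\times G/Z\to Z$ (written $\delta(x,y)$ for $\delta(xZ,yZ)$, and also regarded as a mapping $G\times G\to Z$) such that: $\delta(x,x)=1$ for every $x\in G$; $\delta(x,y)=\delta(y,x)^{-1}$ for every $x,y\in G$; $\delta(xy,z)=\delta(x,z)\delta(y,z)$ whenever $x,y,z\in G$ and $\{x,y,z\}\cap G'\neq\emptyset$; $z^{yx}\delta([z,y],x)=z^{xy}\delta([z,x],y)$ for every $x,y,z\in G$. $\mathrm{Rad}_1\delta=\{t\in G: \delta(tx,y)=\delta(xt,y)=\delta(x,ty)=\delta(x,yt)=\delta(x,y)\text{ for all }x,y\in G\}$, and $\mathrm{Rad}\,\delta$ is the largest normal subgroup of $G$ contained in $\mathrm{Rad}_1\delta$. The mapping $\delta$ is well-defined on $G/\mathrm{Rad}\,\delta\times G/\mathrm{Rad}\,\delta$. An original setup $(G,Z,R,N,\mu,\delta)$ consists of a group $G$ with subgroups satisfying $Z\le R\le N\unlhd G$, $Z\le Z(G)$, $R\unlhd G$, $G'\le N$, $N/R\le Z(G/R)$, a mapping $\mu:G/R\times G/R\to Z$ with $\mu(1,x)=\mu(x,1)=1$ for every $x\in G$, and a mapping $\delta:G/R\times G/R\to Z$, such that (A1), (A2), (A3) of the claim hold and $z^{yx}\delta([z,y],x)=z^{xy}\delta([z,x],y)$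 for every $x,y,z\in G$. The loop $G[\mu]$ of an original setup is the set $G$ with multiplication $x*y=xy\mu(x,y)$. For a loop $Q$ with neutral element $1$, $L_x(y)=xy$, $R_x(y)=yx$, $\mathrm{Mlt}\,Q=\langle L_x,R_x: x\in Q\rangle$, $\mathrm{Inn}\,Q=\{\varphi\in\mathrm{Mlt}\,Q:\varphi(1)=1\}$, and $Z(Q)=\{x\in Q:\varphi(x)=x\text{ for all }\varphi\in\mathrm{Inn}\,Q\}$. Put $Z_0(Q)=1$ and let $Z_{i+1}(Q)$ be the preimage in $Q$ of $Z(Q/Z_i(Q))$; $\mathrm{cl}(Q)$ is the least $m$ with $Z_m(Q)=Q$ ((central) nilpotency class). *)

(* Defs.v *)
From HB Require Import structures.
From mathcomp Require Import all_boot.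
From mathcomp Require Import boolp classical_sets.

Set Implicit Arguments.
Unset Strict Implicit.
Unset Printing Implicit Defensive.

Local Open Scope classical_set_scope.
Local Open Scope group_scope.

(** Loops are handled as pointed magmas [Q : baseUMagmaType] (the structure
    of MathComp carrying a product and a unit but no axiom), together with the
    predicate [is_loop]. Every [groupType] is one, so [Inn], [loop_center],
    [nilpotency_class] apply to groups as well. *)

Section Loops.
Variable Q : baseUMagmaType.

Definition is_loop : Prop :=
  [/\ left_id (1 : Q) *%g, right_id (1 : Q) *%g,
      forall a : Q, bijective (fun x => a * x) &
      forall a : Q, bijective (fun x => x * a)].

(** The group of permutations of [Q] generated by all translations; [MltV]
    is closure under inverses. *)
Inductive Mlt : (Q -> Q) -> Prop :=
  | MltL (x : Q) : Mlt (fun y => x * y)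
  | MltR (x : Q) : Mlt (fun y => y * x)
  | Mlt1 : Mlt id
  | MltM (f g : Q -> Q) : Mlt f -> Mlt g -> Mlt (f \o g)
  | MltV (f g : Q -> Q) : Mlt f -> cancel f g -> cancel g f -> Mlt g.

Definition Inn : set (Q -> Q) := [set f | Mlt f /\ f 1 = 1].

Definition Inn_abelian : Prop :=
  forall f g : Q -> Q, Inn f -> Inn g -> f \o g = g \o f.

Definition loop_center : set Q := [set x | forall f, Inn f -> f x = x].

End Loops.

Arguments Inn : clear implicits.
Arguments loop_center : clear implicits.

Section Quotient.
Variables (Q : baseUMagmaType) (S : set Q).

Definition quot : Type := {A : set Q | exists x, A = [set x * s | s in S]}.

Definition coset (x : Q) : quot := exist _ [set x * s | s in S] (ex_intro _ x erefl).

Definition repr (A : quot) : Q := sval (cid (svalP A)).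

(** Product of cosets through chosen representatives. When [S] is normal it
    does not depend on them; for a normal subgroup see [cosetM]. *)
Definition quot_mul (A B : quot) : quot := coset (repr A * repr B).

HB.instance Definition _ := hasMul.Build quot quot_mul.
HB.instance Definition _ := hasOne.Build quot (coset 1).

End Quotient.

Section Nilpotency.
Variable Q : baseUMagmaType.

Fixpoint upper_center (n : nat) : set Q :=
  if n is m.+1
  then coset (upper_center m) @^-1` loop_center (quot (upper_center m))
  else [set 1].

(** [nilpotency_class m] is cl(Q) = m; no such [m] exists when [Q] is not
    nilpotent. *)
Definition nilpotency_class (m : nat) : Prop :=
  upper_center m = setT /\ forall k, (k < m)%N -> upper_center k <> setT.

Definition nilpotency_class_le (n : nat) : Prop :=
  exists2 m, (m <= n)%N & nilpotency_class m.

End Nilpotency.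

Arguments upper_center : clear implicits.

Section Groups.
Variable G : groupType.
Implicit Types (H K Z R N : set G) (delta mu : G -> G -> G).

Definition subgroup H : Prop :=
  [/\ H 1, forall x y, H x -> H y -> H (x * y) & forall x, H x -> H x^-1].

Definition normal_subgroup H : Prop :=
  subgroup H /\ forall x y, H x -> H (x ^ y).

Definition derived : set G :=
  smallest subgroup [set c | exists x y : G, c = [~ x, y]].

Definition prod_set H K : set G := [set h * k | h in H & k in K].

(** A mapping G/H x G/H -> Z, regarded as a mapping on G x G. *)
Definition coset_mapping H Z (f : G -> G -> G) : Prop :=
  (forall x y, Z (f x y)) /\
  forall x y h k, H h -> H k -> f (x * h) (y * k) = f x y.

(** Linearity in the first (second) argument for triples that meet [N]. *)
Definition linear_l N (f : G -> G -> G) : Prop :=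
  forall x y z, [set x; y; z] `&` N !=set0 -> f (x * y) z = f x z * f y z.

Definition linear_r N (f : G -> G -> G) : Prop :=
  forall x y z, [set x; y; z] `&` N !=set0 -> f x (y * z) = f x y * f x z.

Definition conj_compatible delta : Prop :=
  forall x y z,
    z ^ (y * x) * delta [~ z, y] x = z ^ (x * y) * delta [~ z, x] y.

Definition antisymmetrization delta mu : Prop :=
  forall x y, delta x y = mu x y * (mu y x)^-1.

End Groups.

Arguments derived : clear implicits.

Definition group_center (M : magmaType) : set M :=
  [set z | forall x, commute z x].

Arguments group_center : clear implicits.

Section Setups.
Variable G : groupType.

Record new_setup (Z : set G) (delta : G -> G -> G) : Prop := {
  ns_subgroup : subgroup Z;
  ns_central : Z `<=` group_center G;
  ns_mapping : coset_mapping Z Z delta;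
  ns_diag : forall x, delta x x = 1;
  ns_skew : forall x y, delta x y = (delta y x)^-1;
  ns_linear : linear_l (derived G) delta;
  ns_conj : conj_compatible delta
}.

Definition Rad1 (delta : G -> G -> G) : set G :=
  [set t | forall x y, [/\ delta (t * x) y = delta x y,
                           delta (x * t) y = delta x y,
                           delta x (t * y) = delta x y &
                           delta x (y * t) = delta x y]].

(** The largest normal subgroup contained in [Rad1]: see [Rad_largest]. *)
Definition Rad (delta : G -> G -> G) : set G :=
  \bigcup_(H in [set H | normal_subgroup H /\ H `<=` Rad1 delta]) H.

Record original_setup (Z R N : set G) (mu delta : G -> G -> G) : Prop := {
  os_subgroupZ : subgroup Z;
  os_subZR : Z `<=` R;
  os_subRN : R `<=` N;
  os_normalN : normal_subgroup N;
  os_central : Z `<=` group_center G;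
  os_normalR : normal_subgroup R;
  os_der : derived G `<=` N;
  os_quot_central : coset R @` N `<=` group_center (quot R);
  os_mu : coset_mapping R Z mu;
  os_mu1 : forall x, mu 1 x = 1 /\ mu x 1 = 1;
  os_delta : coset_mapping R Z delta;
  os_A1 : antisymmetrization delta mu;
  os_A2 : linear_l N mu;
  os_A3 : linear_r N mu;
  os_conj : conj_compatible delta
}.

(** G[mu]: the set G with the product x * y * mu x y. *)
Definition setup_loop (mu : G -> G -> G) : Type := G.

HB.instance Definition _ (mu : G -> G -> G) :=
  hasMul.Build (setup_loop mu) (fun x y : G => x * y * mu x y).
HB.instance Definition _ (mu : G -> G -> G) :=
  hasOne.Build (setup_loop mu) (1 : G).

End Setups.

Section Facts.
Variable G : groupType.

Lemma cosetM (R : set G) (x y : G) :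
  normal_subgroup R -> coset R x * coset R y = coset R (x * y).
Proof.
move=> [[R1 RM RV] RJ].
have cosetE (a b : G) : R (a^-1 * b) -> coset R a = coset R b.
  move=> Rab; apply: eq_exist => /=; apply/seteqP; split=> _ [s Rs <-] /=.
    exists ((a^-1 * b)^-1 * s); first by apply: RM => //; exact: RV.
    by rewrite invgM invgK !mulgA mulgV mul1g.
  by exists (a^-1 * b * s); [exact: RM | rewrite !mulgA mulgV mul1g].
have reprP (a : G) : R ((repr (coset R a))^-1 * a).
  rewrite /repr; case: cid => /= b /seteqP [ab _].
  have [|s Rs <-] := ab a; first by exists 1; rewrite ?mulg1.
  by rewrite mulKg.
apply: cosetE.
set a := repr (coset R x); set b := repr (coset R y).
have -> : (a * b)^-1 * (x * y) = (a^-1 * x) ^ b * (b^-1 * y).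
  by rewrite conjgE invgM !mulgA mulgK.
by apply: RM; [apply: RJ; exact: reprP | exact: reprP].
Qed.

Lemma Rad_largest (delta : G -> G -> G) :
  [/\ normal_subgroup (Rad delta), Rad delta `<=` Rad1 delta &
      forall H, normal_subgroup H -> H `<=` Rad1 delta -> H `<=` Rad delta].
Proof.
pose C := [set t | forall x, Rad1 delta (t ^ x)].
have RM t s : Rad1 delta t -> Rad1 delta s -> Rad1 delta (t * s).
  move=> Ht Hs x y.
  by rewrite -!mulgA; case: (Ht (s * x) y) (Hs x y) (Ht x (s * y))
    (Hs (x * t) y) (Ht x y) (Hs x (y * t)) => -> _ _ _ [-> _ -> _] [_ _ -> _]
    [_ h1 _ _] [_ h2 _ h3] [_ _ _ h4]; rewrite !mulgA h1 h2 h4 h3.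
have RV t : Rad1 delta t -> Rad1 delta t^-1.
  move=> Ht x y; split.
  - by case: (Ht (t^-1 * x) y) => <- _ _ _; rewrite mulVKg.
  - by case: (Ht (x * t^-1) y) => _ <- _ _; rewrite mulgVK.
  - by case: (Ht x (t^-1 * y)) => _ _ <- _; rewrite mulVKg.
  - by case: (Ht x (y * t^-1)) => _ _ _ <-; rewrite mulgVK.
have C1 : C `<=` Rad1 delta by move=> t /(_ 1); rewrite conjg1.
have CN : normal_subgroup C.
  split; first split.
  - by move=> x; rewrite conj1g => a b; rewrite !mul1g !mulg1.
  - by move=> t s Ht Hs x; rewrite conjMg; exact: RM.
  - by move=> t Ht x; rewrite conjVg; exact: RV.
  - by move=> t y Ht x; rewrite -conjgM.
have E : Rad delta = C.
  apply/seteqP; split; last by move=> t Ct; exists C.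
  by move=> t [H [[_ HJ] H1] Ht] x; apply/H1/HJ.
rewrite E; split=> // H HN H1; rewrite -E => t Ht; by exists H.
Qed.

End Facts.

(* Main.v *)
From mathcomp Require Import all_boot.
From mathcomp Require Import boolp classical_sets.
Require Import Defs.

(** Comparing the two sides of the conjugation identity of delta gives
      [z ^ (x y), [y, x]] = delta([z, x], y) delta([z, y], x)^-1,
    which lies in Z ([commg_conj]). Hence [G, G'] <= Z ([derived_class2]), G has
    class at most 3, and modulo R = Rad delta the subgroup N = G' R is central.
    A second recurrent fact is that a homomorphism from G to the abelian group Z
    kills G'; so a map on G/R that is linear as soon as one of its arguments
    lies in N is trivial on N x N ([bimapNN]).

    Existence of mu. Write x = s n with s in a transversal of N and n in N. As
    delta is trivial on N x N, delta(s n, t m) = delta(s, t) delta(s, m) delta(n, t).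
    Only delta(s, t) has to be split asymmetrically, and a tournament on the
    transversal does it: mu(s n, t m) is delta(s, m), times delta(s, t) when the
    arc goes from s to t ([exists_polarization]).

    Inner mappings. Every element of Mlt Q has the form u |-> a u^b f(u) with f
    valued in Z and f(u n) = f(u) mu(a, n) delta(n, b) for n in N, because
    translations have this form and it is stable under composition and inversion
    ([Mlt_shape]). If it fixes 1, then a is in Z and can be absorbed in f. For
    two such maps, with conjugators b and d, one composite is the central
    function f(u) h(u) times u^(d b) delta([u, d], b), the other the same function
    times u^(b d) delta([u, b], d). These agree by the conjugation identity
    ([setup_Inn_abelian]).

    Class. Associators of Q lie in Z, and Z is central in Q. Thus the upper
    central series of Q is governed by the group commutators
    ([upper_center_commg]), as if Q were G, from the second term on. An element
    n of N associates with everything, and commutes in Q with z exactly when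
    [n, z] delta(n, z) = 1 ([upper_center1_N]). So Z_2(Q) = Q means that
    [[x, y], z] delta([x, y], z) is always 1, and by the conjugation identity
    this expression is the cyclic product of the theorem ([commg_delta]). *)

Set Implicit Arguments.
Unset Strict Implicit.
Unset Printing Implicit Defensive.

Local Open Scope classical_set_scope.
Local Open Scope group_scope.

(** * Center and upper central series of a loop *)

Section Cosets.
Variables (Q : baseUMagmaType) (S : set Q).

Lemma coset_repr (A : quot S) : coset S (repr A) = A.
Proof.
by case: A => A hA; apply: eq_exist; rewrite /repr; case: cid => x /= ->.
Qed.

Lemma coset_eqW (x y : Q) :
  S 1 -> right_id (1 : Q) *%g -> coset S x = coset S y ->
  exists2 s, S s & x * s = y.
Proof.
move=> S1 m1 /(congr1 sval)/seteqP[_ /(_ y)].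
by case=> [|s Ss <-]; [exists 1 | exists s].
Qed.

End Cosets.

Section LoopCenter.
Variable Q : baseUMagmaType.
Hypothesis Qloop : is_loop Q.
Implicit Types x y z : Q.

Let mul1x x : 1 * x = x. Proof. by case: Qloop. Qed.
Let mulx1 x : x * 1 = x. Proof. by case: Qloop. Qed.

Lemma loop_mulI x : injective (fun y => x * y).
Proof. by case: Qloop => _ _ h _; exact: bij_inj. Qed.

Lemma loop_mulIr x : injective (fun y => y * x).
Proof. by case: Qloop => _ _ _ h; exact: bij_inj. Qed.

Lemma loop_divl x y : exists z, x * z = y.
Proof. by case: Qloop => _ _ /(_ x)[g _ gK] _; exists (g y). Qed.

(** The inner mappings L_y^-1 R_y, L_(yz)^-1 L_y L_z and R_(yz)^-1 R_z R_y express
    that x commutes and associates. Conversely, if x does, every phi in Mlt Q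
    commutes with R_x, so phi(x) = phi(1) x. *)
Lemma loop_centerP x :
  loop_center Q x <->
  [/\ forall y, x * y = y * x,
      forall y z, y * z * x = y * (z * x) &
      forall y z, x * y * z = x * (y * z)].
Proof.
case: (Qloop) => _ _ hL hR; split=> [cx | [P1 P2 P3]].
  split=> [y | y z | y z].
  - case: (hL y) => g gK Kg.
    have /cx E : Inn Q (g \o (fun u => u * y)).
      split; last by rewrite /= mul1x -[X in g X](mulx1 y) gK.
      by apply: MltM; [exact: (MltV (MltL y)) | exact: MltR].
    by rewrite -{2}E /= Kg.
  - case: (hL (y * z)) => g gK Kg.
    have /cx E : Inn Q (g \o (fun u => y * u) \o (fun u => z * u)).
      split; last by rewrite /= mulx1 -[X in g X](mulx1 (y * z)) gK.
      apply: MltM; last exact: MltL.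
      by apply: MltM; [exact: (MltV (MltL (y * z))) | exact: MltL].
    by rewrite -{1}E /= Kg.
  - case: (hR (y * z)) => g gK Kg.
    have /cx E : Inn Q (g \o (fun u => u * z) \o (fun u => u * y)).
      split; last by rewrite /= mul1x -[X in g X](mul1x (y * z)) gK.
      apply: MltM; last exact: MltR.
      by apply: MltM; [exact: (MltV (MltR (y * z))) | exact: MltR].
    by rewrite -{2}E /= Kg.
move=> f [Mf f1].
have fx : forall u, f (u * x) = f u * x.
  elim: {f1} Mf => [y | y | | f' g _ IHf _ IHg | f' g _ IHf fK gK] u //=.
  - by rewrite -!P1 P3.
  - by rewrite IHg IHf.
  - by rewrite -{1}[u]gK -IHf fK.
by rewrite -[in LHS](mul1x x) fx f1 mul1x.
Qed.

Lemma loop_center1 : loop_center Q 1.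
Proof. by move=> f []. Qed.

Lemma loop_centerM x y :
  loop_center Q x -> loop_center Q y -> loop_center Q (x * y).
Proof.
move=> /loop_centerP[x1 x2 x3] /loop_centerP[y1 y2 y3].
apply/loop_centerP; split=> [z | z w | z w].
- by rewrite x3 y1 -x3 x1 y2.
- by rewrite -y2 x2 y2 y2.
- by rewrite !x3 y3.
Qed.

Lemma loop_centerV x : loop_center Q x ->
  exists2 y, loop_center Q y & x * y = 1.
Proof.
move=> /loop_centerP[x1 x2 x3].
have [y xy] := loop_divl x 1; exists y => //; apply/loop_centerP; split.
- move=> z; apply: (@loop_mulI x).
  by rewrite -!x3 xy mul1x x3 x1 x2 -x1 xy mulx1.
- by move=> z w; apply: (@loop_mulIr x); rewrite !x2 -!x1 xy !mulx1.
- by move=> z w; apply: (@loop_mulI x); rewrite -!x3 xy !mul1x.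
Qed.

End LoopCenter.

(** S is encoded as a kernel: its left cosets are the classes of a congruence
    for which cancellation holds in the quotient. The product of [quot S] goes
    through representatives, and [nslM] says that it is well defined. *)
Record normal_subloop (Q : baseUMagmaType) (S : set Q) : Prop := {
  nsl1 : S 1;
  nslM : forall x y, coset S x * coset S y = coset S (x * y);
  nslE : forall x s, S s -> coset S (x * s) = coset S x;
  nslI : forall a x y,
    coset S (a * x) = coset S (a * y) -> coset S x = coset S y;
  nslIr : forall a x y,
    coset S (x * a) = coset S (y * a) -> coset S x = coset S y
}.

Section UpperCenter.
Variable Q : baseUMagmaType.
Hypothesis Qloop : is_loop Q.
Implicit Types (x y z : Q) (S : set Q).

Let mul1x x : 1 * x = x. Proof. by case: Qloop. Qed.
Let mulx1 x : x * 1 = x. Proof. by case: Qloop. Qed.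

Lemma coset_eqP S x y : normal_subloop S ->
  coset S x = coset S y <-> exists2 s, S s & x * s = y.
Proof.
move=> nS; split=> [|[s Ss <-]]; last by rewrite (nslE nS).
by apply: coset_eqW; [exact: nsl1 nS | move=> z; exact: mulx1].
Qed.

Lemma quot_loop S : normal_subloop S -> is_loop (quot S).
Proof.
move=> nS; case: Qloop => _ _ hL hR; split.
- by move=> A; rewrite -[A]coset_repr [LHS](nslM nS) mul1x.
- by move=> A; rewrite -[A]coset_repr [LHS](nslM nS) mulx1.
- move=> A; case: (hL (repr A)) => g gK Kg.
  exists (fun B => coset S (g (repr B))) => B; last first.
    by rewrite -{1}[A]coset_repr (nslM nS) Kg coset_repr.
  rewrite -[RHS]coset_repr; apply: (nslI nS (a := repr A)).
  by rewrite Kg coset_repr -(nslM nS) !coset_repr.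
- move=> A; case: (hR (repr A)) => g gK Kg.
  exists (fun B => coset S (g (repr B))) => B; last first.
    by rewrite -{1}[A]coset_repr (nslM nS) Kg coset_repr.
  rewrite -[RHS]coset_repr; apply: (nslIr nS (a := repr A)).
  by rewrite Kg coset_repr -(nslM nS) !coset_repr.
Qed.

Lemma normal_subloop1 : normal_subloop [set (1 : Q)].
Proof.
have cI x y : coset [set (1 : Q)] x = coset [set (1 : Q)] y -> x = y.
  by case/(coset_eqW erefl mulx1) => s ->; rewrite mulx1.
split=> //.
- move=> x y; congr coset; congr (_ * _); apply: cI; exact: coset_repr.
- by move=> x s ->; rewrite mulx1.
- by move=> a x y /cI/(loop_mulI Qloop) ->.
- by move=> a x y /cI/(loop_mulIr Qloop) ->.
Qed.

(** Two elements are in the same coset of the preimage of the center exactly when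
    their images in Q/S differ by a central factor. As central factors can be
    moved freely through products, this relation is a congruence. *)
Lemma normal_subloop_center S : normal_subloop S ->
  normal_subloop (coset S @^-1` loop_center (quot S)).
Proof.
move=> nS; have lS := quot_loop nS.
set S' := _ @^-1` _; pose C := loop_center (quot S).
have S'1 : S' 1 by exact: loop_center1.
have sub x y c : C c -> coset S x * c = coset S y ->
    sval (coset S' y) `<=` sval (coset S' x).
  move=> Cc xc _ [s Ss <-] /=.
  have [t xt] := loop_divl Qloop x (y * s); exists t => //.
  suff E : coset S t = c * coset S s by rewrite /S' /= E; exact: loop_centerM.
  have /(loop_centerP lS)[_ s2 _] := Ss.
  by apply: (loop_mulI lS (x := coset S x)); rewrite -s2 xc !(nslM nS) xt.
have cE x y : coset S' x = coset S' y <->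
    exists2 c, C c & coset S x * c = coset S y.
  split=> [/(coset_eqW S'1 mulx1)[s Ss <-] | [c Cc xc]].
    by exists (coset S s); rewrite // (nslM nS).
  apply: eq_exist; apply/seteqP; split; last exact: sub xc.
  have [d Cd cd] := loop_centerV lS Cc.
  apply: (sub _ _ d) => //; have /(loop_centerP lS)[_ d2 _] := Cd.
  by rewrite -xc d2 cd; case: lS.
have eC x y c d : C c -> C d ->
    (coset S x * c) * (coset S y * d) = coset S (x * y) * (c * d).
  move=> /(loop_centerP lS)[c1 c2 c3] /(loop_centerP lS)[d1 d2 d3].
  by rewrite -!d2 -(c1 (coset S x)) c3 (nslM nS) c1.
split=> //.
- move=> x y; apply/cE.
  have /cE[c Cc xc] := coset_repr (coset S' x).
  have /cE[d Cd yd] := coset_repr (coset S' y).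
  exists (c * d); first exact: loop_centerM.
  by rewrite -eC // xc yd (nslM nS).
- move=> x s Ss; apply/esym/cE; exists (coset S s) => //; exact: nslM.
- move=> a x y /cE[c Cc axy]; apply/cE; exists c => //.
  have /(loop_centerP lS)[_ c2 _] := Cc.
  by apply: (loop_mulI lS (x := coset S a)); rewrite -c2 !(nslM nS).
- move=> a x y /cE[c Cc axy]; apply/cE; exists c => //.
  have /(loop_centerP lS)[c1 _ c3] := Cc.
  by apply: (loop_mulIr lS (x := coset S a)); rewrite -c1 c3 c1 !(nslM nS).
Qed.

Lemma normal_upper_center n : normal_subloop (upper_center Q n).
Proof.
elim: n => [|n IHn]; first exact: normal_subloop1.
exact: normal_subloop_center.
Qed.

(** An elementwise form of the recursion defining the upper central series: the
    quotients disappear, leaving only a correction s in the previous term. *)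
Lemma mem_upper_centerS n x :
  upper_center Q n.+1 x <->
  [/\ forall y, exists2 s, upper_center Q n s & y * x * s = x * y,
      forall y z, exists2 s, upper_center Q n s & y * (z * x) * s = y * z * x &
      forall y z, exists2 s, upper_center Q n s & x * (y * z) * s = x * y * z].
Proof.
have nS := normal_upper_center n; have lS := quot_loop nS.
have E y z := coset_eqP y z nS.
rewrite /= (loop_centerP lS (coset _ x)); split=> [[c1 c2 c3] | [c1 c2 c3]].
  split=> [y | y z | y z]; apply/E; rewrite -!(nslM nS).
  - by rewrite c1.
  - by rewrite c2.
  - by rewrite c3.
split=> [A | A B | A B].
- by rewrite -(coset_repr A) 2!(nslM nS); apply/esym/E.
- rewrite -(coset_repr A) -(coset_repr B) (nslM nS (repr A)).
  by rewrite (nslM nS (repr B)) 2!(nslM nS); apply/esym/E.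
- rewrite -(coset_repr A) -(coset_repr B) (nslM nS x).
  by rewrite (nslM nS (repr A)) 2!(nslM nS); apply/esym/E.
Qed.

Lemma upper_centerM n x s :
  upper_center Q n x -> upper_center Q n s -> upper_center Q n (x * s).
Proof.
have nS := normal_upper_center n.
move=> Sx Ss; have /(coset_eqP _ _ nS)[t St <-] :
    coset (upper_center Q n) 1 = coset (upper_center Q n) (x * s).
  by rewrite (nslE nS) // -[x]mul1x (nslE nS).
by rewrite mul1x.
Qed.

Lemma upper_center1_sub n : upper_center Q 1 `<=` upper_center Q n.+1.
Proof.
move=> x /mem_upper_centerS[c1 c2 c3]; apply/mem_upper_centerS.
have Z1 := nsl1 (normal_upper_center n).
split=> [y | y z | y z]; exists 1 => //.
- by have [_ -> <-] := c1 y.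
- by have [_ -> <-] := c2 y z.
- by have [_ -> <-] := c3 y z.
Qed.

Lemma upper_centerS_setT n :
  upper_center Q n = setT -> upper_center Q n.+1 = setT.
Proof.
move=> nT; apply/seteqP; split=> // x _; apply/mem_upper_centerS.
have div y z : exists2 s, [set: Q] s & y * s = z.
  by have [s <-] := loop_divl Qloop y z; exists s.
by rewrite nT; split=> *; exact: div.
Qed.

Lemma nilpotency_class_leE n :
  upper_center Q n = setT -> nilpotency_class_le Q n.
Proof.
move=> nT.
have ex : exists m, `[< upper_center Q m = setT >] by exists n; apply/asboolP.
case: (ex_minnP ex) => m /asboolP mT m_min; exists m.
  by apply: m_min; apply/asboolP.
split=> // k km kT; have : (m <= k)%N by apply: m_min; apply/asboolP.
by rewrite leqNgt km.
Qed.

Lemma nilpotency_classSE n :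
  upper_center Q n.+1 = setT ->
  nilpotency_class Q n.+1 <-> upper_center Q n <> setT.
Proof.
move=> nT; split=> [[_] | nT']; first exact.
split=> // k kn kT; apply: nT'.
have {}kn : (k <= n)%N := kn; rewrite -(subnKC kn).
elim: (n - k)%N => [|i IHi]; rewrite ?addn0 ?addnS //.
exact: upper_centerS_setT.
Qed.

End UpperCenter.

(** * Groups *)

Section Groups.
Variable G : groupType.
Implicit Types (x y z t : G) (H N R Z : set G).

Lemma commgMr x y z : [~ x, y * z] = [~ x, z] * [~ x, y] ^ z.
Proof. by rewrite /commg /conjg !gnorm. Qed.

Lemma commgMl x y z : [~ x * y, z] = [~ x, z] ^ y * [~ y, z].
Proof. by rewrite /commg /conjg !gnorm. Qed.

Lemma group_is_loop : is_loop G.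
Proof.
split; [exact: mul1g | exact: mulg1 | |] => a.
  by exists (fun x => a^-1 * x); [exact: mulKg | exact: mulVKg].
by exists (fun x => x * a^-1); [exact: mulgK | exact: mulgVK].
Qed.

Lemma coset_mulr H x h : subgroup H -> H h -> coset H (x * h) = coset H x.
Proof.
move=> [_ HM HV] Hh; apply: eq_exist; apply/seteqP; split=> _ [k Hk <-] /=.
  by exists (h * k); [exact: HM | rewrite mulgA].
by exists (h^-1 * k); [apply: HM => //; exact: HV | rewrite mulgA mulgK].
Qed.

Lemma linear_lP N (f : G -> G -> G) :
  linear_l N f <->
  forall x y z, N x \/ N y \/ N z -> f (x * y) z = f x z * f y z.
Proof.
split=> fl x y z.
  by case=> [Nx|[Ny|Nz]]; apply: fl; [exists x|exists y|exists z];
    split=> //=; [left; left | left; right | right].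
by case=> t [/= [[]|] -> Nt]; apply: fl; [left|right; left|right; right].
Qed.

Lemma linear_rP N (f : G -> G -> G) :
  linear_r N f <->
  forall x y z, N x \/ N y \/ N z -> f x (y * z) = f x y * f x z.
Proof.
split=> fl x y z.
  by case=> [Nx|[Ny|Nz]]; apply: fl; [exists x|exists y|exists z];
    split=> //=; [left; left | left; right | right].
by case=> t [/= [[]|] -> Nt]; apply: fl; [left|right; left|right; right].
Qed.

Lemma subgroup_derived : subgroup (derived G).
Proof.
split=> [|x y dx dy|x dx] H HH; first by case: HH => -[].
- by case: (HH) => -[_ HM _] _; apply: HM; [exact: dx|exact: dy].
- by case: (HH) => -[_ _ HV] _; apply: HV; exact: dx.
Qed.

Lemma derived_commg x y : derived G [~ x, y].
Proof. by apply: sub_gen_smallest; exists x, y. Qed.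

Lemma derived_sub H :
  subgroup H -> (forall x y, H [~ x, y]) -> derived G `<=` H.
Proof. by move=> sH Hc; apply: smallest_sub => // _ [x [y ->]]. Qed.

Lemma normal_derived : normal_subgroup (derived G).
Proof.
split=> [|x y dx]; first exact: subgroup_derived.
case: subgroup_derived => _ dM _.
have -> : x ^ y = x * [~ x, y] by rewrite commgEl mulVKg.
by apply: dM => //; exact: derived_commg.
Qed.

Lemma derived_kernel Z (f : G -> G) t :
  Z `<=` group_center G -> (forall x, Z (f x)) ->
  {morph f : x y / x * y} -> derived G t -> f t = 1.
Proof.
move=> Zc Zf fM; have f1 : f 1 = 1.
  by apply: (@mulgI _ (f 1)); rewrite -fM !mulg1.
have fV x : f x^-1 = (f x)^-1.
  by apply: (@mulgI _ (f x)); rewrite -fM !mulgV.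
apply: (derived_sub (H := [set t | f t = 1])) => [|x y /=].
  split=> //= [x y fx fy | x fx]; first by rewrite fM fx fy mulg1.
  by rewrite fV fx invg1.
apply: (@mulgI _ (f (y * x))).
by rewrite -fM -commgC mulg1 !fM; apply: Zc.
Qed.

End Groups.

(** * Commutators and the form delta in a setup *)

Section NewSetup.
Variables (G : groupType) (Z : set G) (delta : G -> G -> G).
Hypothesis hs : new_setup Z delta.
Let R := Rad delta.
Let N := prod_set (derived G) R.
Implicit Types (x y z t w n m r c : G).

Let Z1 : Z 1. Proof. by case: (ns_subgroup hs). Qed.
Let ZM x y : Z x -> Z y -> Z (x * y).
Proof. by case: (ns_subgroup hs) => _ h _; apply: h. Qed.
Let ZV x : Z x -> Z x^-1. Proof. by case: (ns_subgroup hs) => _ _; apply. Qed.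
Let Zdelta x y : Z (delta x y). Proof. by case: (ns_mapping hs). Qed.

Lemma Z_comm c x : Z c -> c * x = x * c.
Proof. by move=> Zc; apply: (ns_central hs). Qed.

Lemma Z_conj c x : Z c -> c ^ x = c.
Proof. by move=> Zc; rewrite conjgE (Z_comm x Zc) mulKg. Qed.

Lemma normal_Rad : normal_subgroup R.
Proof. by case: (Rad_largest delta). Qed.

Let R1 : R 1. Proof. by case: normal_Rad => -[]. Qed.
Let RM x y : R x -> R y -> R (x * y).
Proof. by case: normal_Rad => -[_ h _] _; apply: h. Qed.
Let RV x : R x -> R x^-1.
Proof. by case: normal_Rad => -[_ _ h] _; apply: h. Qed.
Let RJ x y : R x -> R (x ^ y). Proof. by case: normal_Rad => _; apply. Qed.

Lemma Z_sub_Rad : Z `<=` R.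
Proof.
case: (Rad_largest delta) => _ _; apply; first split.
- exact: ns_subgroup hs.
- by move=> x y Zx; rewrite Z_conj.
move=> t Zt x y; case: (ns_mapping hs) => _ h.
have E u v : delta (u * t) v = delta u v by rewrite -[v]mulg1 h // mulg1.
have E' u v : delta u (v * t) = delta u v by rewrite -[u]mulg1 h // mulg1.
by rewrite !(Z_comm _ Zt).
Qed.

Let der_N : derived G `<=` N.
Proof. by move=> t dt; exists t => //; exists 1; rewrite ?mulg1. Qed.

Let R_N : R `<=` N.
Proof.
move=> r Rr; exists 1; first by case: (subgroup_derived G).
by exists r; rewrite ?mul1g.
Qed.

Let N1 : N 1. Proof. exact: R_N. Qed.

Lemma normal_N : normal_subgroup N.
Proof.
have [[d1 dM dV] dJ] := normal_derived G.
split; first split=> //.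
- move=> _ _ [g dg [r Rr <-]] [h dh [s Rs <-]].
  exists (g * h); first exact: dM.
  exists (r ^ h * s); first by apply: RM => //; exact: RJ.
  rewrite !mulgA; congr (_ * _).
  by rewrite -!mulgA; congr (_ * _); rewrite -conjgC.
- move=> _ [g dg [r Rr <-]]; exists g^-1; first exact: dV.
  by exists (r^-1 ^ g^-1); [apply/RJ/RV | rewrite -conjgC invgM].
move=> _ y [g dg [r Rr <-]]; exists (g ^ y); first exact: dJ.
by exists (r ^ y); [exact: RJ | rewrite conjMg].
Qed.

Let NM x y : N x -> N y -> N (x * y).
Proof. by case: normal_N => -[_ h _] _; apply: h. Qed.
Let NV x : N x -> N x^-1. Proof. by case: normal_N => -[_ _ h] _; apply: h. Qed.
Let NJ x y : N x -> N (x ^ y). Proof. by case: normal_N => _; apply. Qed.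

(** Since y x = x y [y, x], the conjugates of z by y x and by x y differ by the
    commutator on the left, while the conjugation identity computes their
    quotient. *)
Lemma commg_conj x y z :
  [~ z ^ (x * y), [~ y, x]] = delta [~ z, x] y * (delta [~ z, y] x)^-1.
Proof.
apply: (@mulgI _ (z ^ (x * y))).
by rewrite [RHS]mulgA -(ns_conj hs) mulgK (commgEl (z ^ _)) mulVKg -conjgM -commgC.
Qed.

(** Every w is of the form z ^ (x y), so [commg_conj] puts [w, [y, x]] in the
    central subgroup Z; those t with [w, t] in Z for all w form a subgroup. *)
Lemma derived_class2 w t : derived G t -> Z [~ w, t].
Proof.
move=> dt; move: t dt w.
apply: (derived_sub (H := [set t | forall w, Z [~ w, t]])) => [|y x w /=].
  split=> /= [w | s t Zs Zt w | t Zt w]; first by rewrite commg1.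
    by rewrite commgMr Z_conj //; exact: ZM.
  suff -> : [~ w, t^-1] = [~ w, t]^-1 by exact: ZV.
  apply: (@mulIg _ ([~ w, t] ^ t^-1)); rewrite -commgMr mulgV commg1.
  by rewrite Z_conj // mulVg.
rewrite -[w](conjgKV (x * y)) commg_conj.
by apply: ZM => //; exact: ZV.
Qed.

Lemma commg_derivedM t w w' : derived G t -> [~ w * w', t] = [~ w, t] * [~ w', t].
Proof. by move=> dt; rewrite commgMl Z_conj //; exact: derived_class2. Qed.

(** w |-> [w, t] is a homomorphism into the abelian group Z, hence invariant under
    conjugation. It lets [commg_conj] be read with z in place of z ^ (x y). *)
Lemma commg_derivedJ t w u : derived G t -> [~ w ^ u, t] = [~ w, t].
Proof.
move=> dt; have -> : w ^ u = w * [~ w, u] by rewrite commgEl mulVKg.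
rewrite commg_derivedM // -[RHS]mulg1; congr (_ * _).
apply: (derived_kernel (f := fun w => [~ w, t]) (ns_central hs)).
- by move=> x; exact: derived_class2.
- by move=> x y; exact: commg_derivedM.
- exact: derived_commg.
Qed.

Lemma delta_Rad : coset_mapping R Z delta.
Proof.
split=> // x y r s Rr Rs; case: (Rad_largest delta) => _ h _.
case: (h _ Rr x (y * s)) => _ -> _ _.
by case: (h _ Rs x y).
Qed.

Section CosetMap.
Variable f : G -> G -> G.
Hypothesis fR : coset_mapping R Z f.

Lemma coset_mapZ x y : Z (f x y). Proof. by case: fR. Qed.

Lemma coset_mapl x y r : R r -> f (x * r) y = f x y.
Proof. by move=> Rr; case: fR => _ h; rewrite -[y in LHS]mulg1 h. Qed.

Lemma coset_mapr x y r : R r -> f x (y * r) = f x y.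
Proof. by move=> Rr; case: fR => _ h; rewrite -[x in LHS]mulg1 h. Qed.

End CosetMap.

Lemma delta_linear_l : linear_l N delta.
Proof.
have dl := coset_mapl delta_Rad; have dr := coset_mapr delta_Rad.
have /linear_lP h := ns_linear hs.
apply/linear_lP => x y z [|[]] [g dg [r Rr <-]].
- have -> : g * r * y = g * y * r ^ y by rewrite -!mulgA -conjgC.
  by rewrite (dl _ _ _ (RJ y Rr)) (dl _ _ _ Rr); apply: h; left.
- by rewrite mulgA !(dl _ _ _ Rr); apply: h; right; left.
- by rewrite !(dr _ _ _ Rr); apply: h; right; right.
Qed.

Lemma delta_linear_r : linear_r N delta.
Proof.
have /linear_lP h := delta_linear_l.
apply/linear_rP => x y z H; rewrite !(ns_skew hs x) h ?invgM; last tauto.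
by rewrite -Z_comm //; exact: ZV.
Qed.

Section Bilinear.
Variable f : G -> G -> G.
Hypotheses (fR : coset_mapping R Z f) (fl : linear_l N f) (fr : linear_r N f).

Lemma bimapMl x y z : N x \/ N y \/ N z -> f (x * y) z = f x z * f y z.
Proof. by move/linear_lP: fl; apply. Qed.

Lemma bimapMr x y z : N x \/ N y \/ N z -> f x (y * z) = f x y * f x z.
Proof. by move/linear_rP: fr; apply. Qed.

Lemma bimap1l z : f 1 z = 1.
Proof.
by apply: (@mulgI _ (f 1 z)); rewrite -bimapMl ?mulg1 //; left.
Qed.

Lemma bimap1r z : f z 1 = 1.
Proof.
by apply: (@mulgI _ (f z 1)); rewrite -bimapMr ?mulg1 //; right; left.
Qed.

Lemma bimapRl r z : R r -> f r z = 1.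
Proof. by move=> Rr; rewrite -[r]mul1g (coset_mapl fR) // bimap1l. Qed.

Lemma bimapRr r z : R r -> f z r = 1.
Proof. by move=> Rr; rewrite -[r]mul1g (coset_mapr fR) // bimap1r. Qed.

(** For m in N the map f(_, m) is a homomorphism into the abelian group Z: it kills
    G', and it kills R because f is a map on G/R. *)
Lemma bimapNN n m : N n -> N m -> f n m = 1.
Proof.
move=> [g dg [r Rr <-]] Nm; rewrite (coset_mapl fR) //.
apply: (derived_kernel (f := fun x => f x m) (ns_central hs)) dg.
  by move=> x; exact: coset_mapZ fR _ _.
by move=> x y; apply: bimapMl; right; right.
Qed.

Lemma bimapVl n z : N n \/ N z -> f n^-1 z = (f n z)^-1.
Proof.
move=> Nnz; apply: (@mulIg _ (f n z)).
rewrite -bimapMl ?mulVg ?bimap1l //.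
by case: Nnz => ?; [right; left | right; right].
Qed.

Lemma bimapVr n z : N n \/ N z -> f z n^-1 = (f z n)^-1.
Proof.
move=> Nnz; apply: (@mulIg _ (f z n)).
rewrite -bimapMr ?mulVg ?bimap1r //.
by case: Nnz => ?; [right; right | left].
Qed.

End Bilinear.

Lemma commg_N_Rad n x : N n -> R [~ x, n].
Proof.
move=> [g dg [r Rr <-]]; rewrite commgMr; apply: RM.
  by rewrite commgEr; apply: RM => //; apply/RJ/RV.
by apply/RJ/Z_sub_Rad/derived_class2.
Qed.

(** [[x, y], z] is the inverse of [z, [x, y]], which [commg_conj] evaluates. *)
Lemma commg_delta x y z :
  [~ [~ x, y], z] * delta [~ x, y] z =
  delta [~ x, y] z * delta [~ y, z] x * delta [~ z, x] y.
Proof.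
have dxy := derived_commg x y.
rewrite -[in LHS](invgR z) -(commg_derivedJ z (y * x) dxy) commg_conj.
rewrite invgM invgK -(bimapVl delta_linear_l); last first.
  by left; exact: der_N (derived_commg _ _).
by rewrite invgR -Z_comm // (Z_comm (delta [~ y, z] x)) // !mulgA.
Qed.


(** * Existence of the polarization mu *)

Section Polarization.

(** The transversal of N must represent N itself by 1: only then is [half] trivial
    as soon as one of its arguments represents an element of N. *)
Let rho x := if `[< N x >] then 1 else repr (coset N x).
Let rem x := (rho x)^-1 * x.

Let rho_rem x : rho x * rem x = x. Proof. exact: mulVKg. Qed.

Let rho_N x : N x -> rho x = 1.
Proof. by move=> Nx; rewrite /rho asboolT. Qed.

Let rem_N x : N (rem x).
Proof.
rewrite /rem /rho; case: asboolP => [Nx | _]; first by rewrite invg1 mul1g.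
have [n Nn xn] := coset_eqW N1 (@mulg1 G) (coset_repr (coset N x)).
by rewrite -[X in _ * X]xn mulKg.
Qed.

Let rhoM x n : N n -> rho (x * n) = rho x.
Proof.
move=> Nn; rewrite /rho (coset_mulr _ (proj1 normal_N) Nn).
suff -> : N (x * n) = N x by [].
apply/propext; split=> [Nxn | Nx]; last exact: NM.
by rewrite -(mulgK n x); apply: NM => //; exact: NV.
Qed.

Let rhoMl x n : N n -> rho (n * x) = rho x.
Proof. by move=> Nn; rewrite conjgC rhoM //; exact: NJ. Qed.

Let remM x n : N n -> rem (x * n) = rem x * n.
Proof. by move=> Nn; rewrite /rem rhoM // mulgA. Qed.

(** A tournament: a choice function applied to the unordered pair {x, y} selects
    an orientation of it. *)
Let tour x y : bool :=
  xget (1, 1) [set p | p = (x, y) \/ p = (y, x)] == (x, y).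

Let tourC x y : x <> y -> tour y x = ~~ tour x y.
Proof.
move=> xy; rewrite /tour.
have -> : [set p | p = (y, x) \/ p = (x, y)] = [set p | p = (x, y) \/ p = (y, x)].
  by apply/seteqP; split=> p /=; tauto.
set P := [set p | _].
have : P (xget (1, 1) P) by apply: (@xgetI _ _ _ (x, y)); left.
case=> ->; rewrite eqxx; first by apply/eqP => -[].
by apply/esym/negPf/negP => -/eqP[].
Qed.

Let half x y := if tour x y then delta x y else 1.

Let half_antisym x y : half x y * (half y x)^-1 = delta x y.
Proof.
case: (pselect (x = y)) => [-> | xy]; first by rewrite mulgV (ns_diag hs).
rewrite /half (tourC xy); case: tour => /=; first by rewrite invg1 mulg1.
by rewrite mul1g -(ns_skew hs).
Qed.

Let half1l x : half 1 x = 1.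
Proof. by rewrite /half (bimap1l delta_linear_l); case: ifP. Qed.

Let half1r x : half x 1 = 1.
Proof. by rewrite /half (bimap1r delta_linear_r); case: ifP. Qed.

Let Zhalf x y : Z (half x y).
Proof. by rewrite /half; case: ifP. Qed.

Let mu x y := half (rho x) (rho y) * delta x (rem y).

(** mu(x, y) keeps delta(x, m), where m is the N-part of y; the missing factor of
    delta(x, y), the inverse of delta(y, n) with n the N-part of x, comes from
    mu(y, x). *)
Lemma exists_polarization :
  exists mu : G -> G -> G,
     [/\ coset_mapping R Z mu, antisymmetrization delta mu,
         linear_l N mu & linear_r N mu].
Proof.
have dl x y z := @bimapMl _ delta_linear_l x y z.
have dr x y z := @bimapMr _ delta_linear_r x y z.
have dNN n m := @bimapNN _ delta_Rad delta_linear_l n m.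
exists mu; split.
- split=> [x y | x y r s Rr Rs]; first exact: ZM.
  rewrite /mu !rhoM ?remM; try exact: R_N.
  by case: delta_Rad => _ ->.
- move=> x y.
  have E : delta x y =
      delta (rho x) (rho y) * (delta x (rem y) * (delta y (rem x))^-1).
    rewrite -(ns_skew hs) -[in LHS](rho_rem y) dr; last by right; right.
    rewrite Z_comm // [RHS]Z_comm // -mulgA; congr (_ * _).
    have -> : delta (rem x) y = delta (rem x) (rho y).
      rewrite -[in LHS](rho_rem y) dr; last by left.
      by rewrite [delta _ (rem y)]dNN // mulg1.
    by rewrite Z_comm // -dl ?rho_rem //; right; left.
  rewrite E -half_antisym /mu invgM -!mulgA; congr (_ * _).
  rewrite (Z_comm _ (ZV (Zhalf _ _))) -!mulgA; congr (_ * _).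
- apply/linear_lP => x y z; rewrite /mu => -[Nx | [Ny | Nz]].
  + rewrite (rhoMl _ Nx) (rho_N Nx) half1l mul1g dl; last by left.
    by rewrite (dNN x) // !mul1g.
  + rewrite (rhoM _ Ny) (rho_N Ny) half1l mul1g dl; last by right; left.
    by rewrite (dNN y) // !mulg1.
  + by rewrite (rho_N Nz) !half1r !mul1g dl //; right; right.
- apply/linear_rP => x y z; rewrite /mu => -[Nx | [Ny | Nz]].
  + by rewrite (rho_N Nx) !half1l !mul1g !dNN // mulg1.
  + have remy : rem y = y by rewrite /rem rho_N // invg1 mul1g.
    rewrite (rhoMl _ Ny) (rho_N Ny) half1r mul1g remy.
    rewrite (conjgC y z) remM; last exact: NJ.
    rewrite dr; last by right; left.
    have -> : y ^ z = y * [~ y, z] by rewrite commgEl mulVKg.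
    rewrite (coset_mapr delta_Rad); last by rewrite -invgR; apply/RV/commg_N_Rad.
    by rewrite [RHS]Z_comm // mulgA.
  + rewrite (rhoM _ Nz) (rho_N Nz) half1r mul1g remM // dr; last by right; right.
    by rewrite /rem (rho_N Nz) invg1 mul1g mulgA.
Qed.

End Polarization.

(** * The loop of a setup *)

Section LoopOfSetup.
Variable mu : G -> G -> G.
Hypotheses (muR : coset_mapping R Z mu) (muA : antisymmetrization delta mu).
Hypotheses (mu_linl : linear_l N mu) (mu_linr : linear_r N mu).
Let Q : baseUMagmaType := setup_loop mu.

Let Zmu x y : Z (mu x y). Proof. exact: (coset_mapZ muR). Qed.

Let Zcommr x c : Z c -> x * c = c * x.
Proof. by move=> Zc; exact/esym/Z_comm. Qed.

Let mulACA x y c z : Z c -> x * c * (y * z) = x * y * (c * z).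
Proof. by move=> Zc; rewrite !mulgA -(mulgA x) (Z_comm y Zc) !mulgA. Qed.

Lemma setup_original : original_setup Z R N mu delta.
Proof.
split => //.
- exact: Z_sub_Rad.
- exact: ns_central hs.
- move=> _ [n Nn <-] A; rewrite /commute -(coset_repr A).
  rewrite !(cosetM _ _ normal_Rad) commgC (coset_mulr _ (proj1 normal_Rad)) //.
  by rewrite -invgR; apply/RV/commg_N_Rad.
- by move=> x; rewrite (bimap1l mu_linl) (bimap1r mu_linr).
- exact: delta_Rad.
- exact: ns_conj hs.
Qed.

Lemma loop_mulE x y : (x : Q) * (y : Q) = (x * y * mu x y : G).
Proof. by []. Qed.

Lemma setup_is_loop : is_loop Q.
Proof.
split.
- by move=> x; rewrite loop_mulE (bimap1l mu_linl) mulg1 mul1g.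
- by move=> x; rewrite loop_mulE (bimap1r mu_linr) !mulg1.
- move=> a; exists (fun y : G => a^-1 * y * (mu a (a^-1 * y))^-1) => x.
    rewrite !loop_mulE -(mulgA a) mulKg (coset_mapr muR) ?mulgK //.
    exact: Z_sub_Rad.
  rewrite loop_mulE (coset_mapr muR _ (a^-1 * x)); last exact: Z_sub_Rad (ZV _).
  by rewrite !mulgA mulgV mul1g mulgVK.
- move=> a; exists (fun y : G => y * a^-1 * (mu (y * a^-1) a)^-1) => x.
    rewrite !loop_mulE -(mulgA x) (Zcommr a) // mulgA mulgK.
    rewrite (coset_mapl muR) ?mulgK //; exact: Z_sub_Rad.
  rewrite loop_mulE (coset_mapl muR (x * a^-1)); last exact: Z_sub_Rad (ZV _).
  by rewrite -(mulgA (x * _)) (Z_comm a) ?mulgA ?mulgVK //; exact: ZV.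
Qed.

Lemma mu_conjl n x y : N n -> mu (x ^ y) n = mu x n.
Proof.
move=> Nn; have -> : x ^ y = x * [~ x, y] by rewrite commgEl mulVKg.
rewrite (bimapMl mu_linl); last by right; right.
by rewrite (bimapNN muR mu_linl (der_N (derived_commg _ _))) // mulg1.
Qed.

(** The law for f carries mu(a, n) and delta(n, b) because this is what R_x and
    L_x satisfy. It survives composition since it depends on a and b only through
    homomorphisms into Z, for which a c^b and a c are the same, and since n^d and
    n agree modulo R. *)
Lemma Mlt_shape (phi : Q -> Q) : Mlt phi ->
  exists a b (f : G -> G),
    [/\ forall u, phi u = a * u ^ b * f u, forall u, Z (f u) &
        forall u n, N n -> f (u * n) = f u * (mu a n * delta n b)].
Proof.
have invar a b (f : G -> G) :
    (forall u n, N n -> f (u * n) = f u * (mu a n * delta n b)) ->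
    forall u r, R r -> f (u * r) = f u.
  move=> flaw u r Rr; rewrite flaw; last exact: R_N.
  by rewrite (bimapRr muR mu_linr) // (bimapRl delta_Rad delta_linear_l) // !mulg1.
have conjN n d : N n -> exists2 r, R r & n ^ d = n * r.
  move=> Nn; exists [~ n, d]; last by rewrite commgEl mulVKg.
  by rewrite -invgR; apply/RV/commg_N_Rad.
elim=> [x | x | | f g _ [a [b [F [fE ZF Flaw]]]] _ [c [d [H [gE ZH Hlaw]]]] |
        f g _ [a [b [F [fE ZF Flaw]]]] fK gK].
- exists x, 1, (mu x); split=> [u | u | u n Nn] //; first by rewrite conjg1.
  by rewrite (bimapMr mu_linr) ?(bimap1r delta_linear_r) ?mulg1 //; right; right.
- exists x, x, (mu^~ x); split=> [u | u | u n Nn] //; first by rewrite -conjgC.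
  rewrite (bimapMl mu_linl); last by right; left.
  by rewrite (muA n) (Zcommr (mu x n)) ?mulgVK //; apply: ZM (ZV _).
- exists 1, 1, (fun=> 1); split=> [u | u | u n Nn] //.
    by rewrite conjg1 mul1g mulg1.
  by rewrite (bimap1l mu_linl) (bimap1r delta_linear_r) !mulg1.
- have Finv := invar _ _ _ Flaw.
  exists (a * c ^ b), (d * b), (fun u => H u * F (c * u ^ d)).
  split=> [u | u | u n Nn].
  + rewrite /= gE fE Finv; last exact: Z_sub_Rad.
    by rewrite 2!conjMg (Z_conj b (ZH u)) -conjgM !mulgA.
  + exact: ZM.
  + have [r Rr nr] := conjN n d Nn.
    have -> : c * (u * n) ^ d = c * u ^ d * n * r by rewrite conjMg nr !mulgA.
    rewrite Finv // Flaw // Hlaw //.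
    rewrite mulACA; last exact: ZM.
    congr (_ * _); rewrite mulACA //.
    rewrite (bimapMl mu_linl); last by right; right.
    rewrite mu_conjl // (bimapMr delta_linear_r); last by left.
    by rewrite (Zcommr (mu c n)).
- have Finv := invar _ _ _ Flaw.
  exists (a^-1 ^ b^-1), b^-1, (fun v => (F ((a^-1 * v) ^ b^-1))^-1).
  split=> [v | v | v n Nn].
  + rewrite -{2 3}[v]gK; move: (g v) => u.
    have E : (a^-1 * (f u : G)) ^ b^-1 = (u : G) * F u.
      by rewrite fE -(mulgA a) mulKg conjMg conjgK (Z_conj _ (ZF u)).
    by rewrite -conjMg E Finv ?mulgK //; exact: Z_sub_Rad.
  + exact: ZV.
  + have [r Rr nr] := conjN n b^-1 Nn.
    have -> : (a^-1 * (v * n)) ^ b^-1 = (a^-1 * v) ^ b^-1 * n * r.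
      by rewrite mulgA conjMg nr mulgA.
    rewrite Finv // Flaw // invgM [LHS]Zcommr; last exact: ZV.
    congr (_ * _); rewrite mu_conjl //.
    rewrite (bimapVl mu_linl); last by right.
    rewrite (bimapVr delta_linear_r); last by right.
    by rewrite invgM Zcommr //; exact: ZV.
Qed.

(** The value at 1 is a f(1), so a lies in Z, which is contained in R; thus
    mu(a, n) = 1 and a can be moved into f. *)
Lemma Inn_shape (phi : Q -> Q) : Inn Q phi ->
  exists b (f : G -> G),
    [/\ forall u, phi u = u ^ b * f u, forall u, Z (f u) &
        forall u n, N n -> f (u * n) = f u * delta n b].
Proof.
move=> [/Mlt_shape[a [b [f [phiE Zf flaw]]]] phi1].
have af : a = (f 1)^-1.
  have : (a * (1 : G) ^ b * f 1 = 1 :> G) by rewrite -phiE; exact: phi1.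
  by rewrite conj1g mulg1 => af1; apply: (@mulIg _ (f 1)); rewrite mulVg.
have Za : Z a by rewrite af; exact: ZV.
exists b, (fun u => a * f u); split=> [u | u | u n Nn].
- by rewrite phiE (Z_comm _ Za) -!mulgA (Z_comm _ Za).
- exact: ZM.
- by rewrite flaw // (bimapRl muR mu_linl n (Z_sub_Rad Za)) mul1g mulgA.
Qed.

Lemma setup_Inn_abelian : Inn_abelian Q.
Proof.
move=> phi psi /Inn_shape[b [f [phiE Zf flaw]]] /Inn_shape[d [h [psiE Zh hlaw]]].
(* u ^ c = u [u, c] with [u, c] in N, so the law for k applies. *)
have shift c e (k : G -> G)
    (kl : forall u n, N n -> k (u * n) = k u * delta n e) u z :
    Z z -> k (u ^ c * z) = k u * delta [~ u, c] e.
  move=> Zz; rewrite kl; last exact: R_N (Z_sub_Rad Zz).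
  rewrite (bimapRl delta_Rad delta_linear_l); last exact: Z_sub_Rad.
  have -> : u ^ c = u * [~ u, c] by rewrite commgEl mulVKg.
  by rewrite kl ?mulg1 //; exact: der_N (derived_commg _ _).
apply/funext => u /=; rewrite phiE psiE psiE phiE.
rewrite (shift _ _ _ flaw) // (shift _ _ _ hlaw) //.
rewrite (conjMg (u ^ d)) (conjMg (u ^ b)) (Z_conj b (Zh u)) (Z_conj d (Zf u)).
rewrite -!conjgM.
rewrite (Zcommr (f u) (Zdelta _ _)) (Zcommr (h u) (Zdelta _ _)).
by rewrite (mulACA _ _ _ (Zh u)) (mulACA _ _ _ (Zf u)) (ns_conj hs) (Z_comm (h u)).
Qed.

Lemma mul_assocl x y z :
  ((x : Q) * ((y : Q) * (z : Q)) : Q) = (x * y * z * (mu y z * mu x (y * z)) : G).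
Proof.
by rewrite !loop_mulE (coset_mapr muR) ?mulgA //; exact: Z_sub_Rad.
Qed.

Lemma mul_assocr x y z :
  ((x : Q) * (y : Q) * (z : Q) : Q) = (x * y * z * (mu x y * mu (x * y) z) : G).
Proof.
rewrite !loop_mulE (coset_mapl muR); last exact: Z_sub_Rad.
by rewrite -(mulgA (x * y)) (Z_comm z (Zmu x y)) !mulgA.
Qed.

(** The factor s that turns y x into x y in Q is [x, y] up to an element of Z. *)
Lemma mul_commE x y (s : G) :
  (y : Q) * (x : Q) * (s : Q) = (x : Q) * (y : Q) <->
  s = [~ x, y] * (mu x y * (mu y x * mu (y * x) s)^-1).
Proof.
have -> : (y : Q) * (x : Q) * (s : Q) =
    (y * x * (s * (mu y x * mu (y * x) s)) : G).
  by rewrite mul_assocr [RHS]mulgA.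
have -> : (x : Q) * (y : Q) = (y * x * ([~ x, y] * mu x y) : G).
  by rewrite loop_mulE (commgC x y) [RHS]mulgA.
split=> [/mulgI E | E]; first by rewrite (mulgA [~ x, y]) -E mulgK.
by rewrite {1}E (mulgA [~ x, y]) mulgVK.
Qed.

(** When n is in N, linearity of mu makes all associators involving n trivial, and
    only commutation remains. *)
Lemma upper_center1_N n : N n ->
  upper_center Q 1 n <-> forall z, [~ n, z] * delta n z = 1.
Proof.
move=> Nn; have E z : ((n : Q) * (z : Q) = (z : Q) * (n : Q)) <->
    [~ n, z] * delta n z = 1.
  rewrite !loop_mulE (commgC n z) -(mulgA (z * n)) muA (mulgA [~ n, z]).
  split=> [/mulgI -> | /divg1_eq -> //]; exact: mulgV.
split=> [/(mem_upper_centerS setup_is_loop)[c _ _] z | nz].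
  by apply/E; have [s -> <-] := c z; case: setup_is_loop => _ ->.
apply/(mem_upper_centerS setup_is_loop).
have eq1 (u v : Q) : u = v -> exists2 s : Q, s = 1 & u * s = v.
  by move=> ->; exists 1 => //; case: setup_is_loop => _ ->.
split=> [z | y z | y z]; apply: eq1; first exact/esym/E.
- rewrite mul_assocl mul_assocr; apply: (congr1 (@monoid.mul G _)).
  rewrite (bimapMl mu_linl); last by right; right.
  rewrite (bimapMr mu_linr); last by right; right.
  by rewrite [LHS]Z_comm // mulgA.
- rewrite mul_assocl mul_assocr; apply: (congr1 (@monoid.mul G _)).
  rewrite (bimapMl mu_linl); last by left.
  rewrite (bimapMr mu_linr); last by left.
  by rewrite [LHS]Z_comm // mulgA.
Qed.

Lemma Z_upper_center (n : nat) c : Z c -> upper_center Q n.+1 c.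
Proof.
move=> Zc; apply: (upper_center1_sub setup_is_loop).
apply/(upper_center1_N (R_N (Z_sub_Rad Zc))) => z.
rewrite (bimapRl delta_Rad delta_linear_l); last exact: Z_sub_Rad.
by rewrite mulg1 commgEl Z_conj // mulVg.
Qed.

Lemma mulQ_Z x c : Z c -> (x : Q) * (c : Q) = (x * c : G).
Proof.
by move=> Zc; rewrite loop_mulE (bimapRr muR mu_linr) ?mulg1 //; exact: Z_sub_Rad.
Qed.

Lemma upper_centerM_Z (n : nat) x c :
  Z c -> upper_center Q n.+1 x -> upper_center Q n.+1 (x * c : G).
Proof.
move=> Zc ux; rewrite -(mulQ_Z x Zc).
by apply: (upper_centerM setup_is_loop) => //; exact: Z_upper_center.
Qed.

(** As associators lie in Z, which is already in the first term, only commutators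
    count from the second term on; by [mul_commE] a commutator of Q is a group
    commutator up to Z. *)
Lemma upper_center_commg (n : nat) x :
  upper_center Q n.+2 x <-> forall y, upper_center Q n.+1 [~ x, y].
Proof.
split=> [/(mem_upper_centerS setup_is_loop)[c _ _] y | cx].
  have [s us /mul_commE E] := c y.
  suff -> : [~ x, y] = (s : G) * (mu x y * (mu y x * mu (y * x) s)^-1)^-1.
    apply: upper_centerM_Z => //; apply: ZV.
    by apply: ZM => //; apply: ZV; exact: ZM.
  by rewrite {1}E mulgK.
have ass (p c d : G) : Z c -> Z d -> exists2 s : Q,
    upper_center Q n.+1 s & ((p * c : G) : Q) * s = (p * d : G).
  move=> Zc Zd; exists (c^-1 * d).
    by apply: Z_upper_center; apply: ZM => //; exact: ZV.
  by rewrite mulQ_Z ?mulgA ?mulgK //; apply: ZM => //; exact: ZV.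
apply/(mem_upper_centerS setup_is_loop); split=> [y | y z | y z].
- exists ([~ x, y] * (mu x y * (mu y x * mu ((y : G) * x) [~ x, y])^-1) : G).
    by apply: upper_centerM_Z => //; apply: ZM => //; apply: ZV; exact: ZM.
  apply/mul_commE; congr (_ * (_ * (_ * _)^-1)).
  apply: esym; apply: (coset_mapr muR); apply: Z_sub_Rad.
  by apply: ZM => //; apply: ZV; exact: ZM.
- by rewrite mul_assocl mul_assocr; apply: ass; exact: ZM.
- by rewrite mul_assocl mul_assocr; apply: ass; exact: ZM.
Qed.

Lemma upper_center2_derived : derived G `<=` upper_center Q 2.
Proof.
move=> t dt; apply/upper_center_commg => y; apply: Z_upper_center.
by rewrite -invgR; apply/ZV/derived_class2.
Qed.

Lemma upper_center3 : upper_center Q 3 = setT.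
Proof.
apply/seteqP; split=> // x _; apply/upper_center_commg => y.
exact: upper_center2_derived (derived_commg _ _).
Qed.

Lemma upper_center2P : upper_center Q 2 = setT <->
  forall x y z, delta [~ x, y] z * delta [~ y, z] x * delta [~ z, x] y = 1.
Proof.
split=> [Q2 x y z | E].
  rewrite -commg_delta; move: z.
  apply/(upper_center1_N (der_N (derived_commg x y))).
  by move: y; apply/upper_center_commg; rewrite Q2.
apply/seteqP; split=> // x _; apply/upper_center_commg => y.
apply/(upper_center1_N (der_N (derived_commg x y))) => z.
by rewrite commg_delta.
Qed.

End LoopOfSetup.

Lemma group_class3 : upper_center G 3 = setT.
Proof.
have lG := group_is_loop G.
have up (n : nat) x :
    (forall y, upper_center G n [~ x, y]) -> upper_center G n.+1 x.
  move=> h; have n1 := nsl1 (normal_upper_center lG n).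
  apply/(mem_upper_centerS lG); split=> [y | y z | y z].
  - by exists [~ x, y]; rewrite // -commgC.
  - by exists 1; rewrite // mulg1 mulgA.
  - by exists 1; rewrite // mulg1 mulgA.
apply/seteqP; split=> // x _; apply: (up 2) => y; apply: (up 1%N) => z.
apply: (up 0%N) => t.
have Zc : Z [~ [~ x, y], z].
  by rewrite -invgR; apply: ZV; apply: derived_class2; exact: derived_commg.
by rewrite /= commgEl Z_conj // mulVg.
Qed.

End NewSetup.

Theorem proposition5p5 (G : groupType) (Z : set G) (delta : G -> G -> G)
    (hsetup : new_setup Z delta) :
  let R := Rad delta in
  let N := prod_set (derived G) R in
  (exists mu : G -> G -> G,
     [/\ coset_mapping R Z mu, antisymmetrization delta mu,
         linear_l N mu & linear_r N mu]) /\
  (forall mu : G -> G -> G,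
     coset_mapping R Z mu -> antisymmetrization delta mu ->
     linear_l N mu -> linear_r N mu ->
     original_setup Z R N mu delta /\
     (let Q : baseUMagmaType := setup_loop mu in
      [/\ is_loop Q,
          nilpotency_class_le G 3 /\ nilpotency_class_le Q 3,
          Inn_abelian Q &
          nilpotency_class Q 3 <->
          exists x y z : G,
            delta [~ x, y] z * delta [~ y, z] x * delta [~ z, x] y <> 1])).
Proof.
move=> R N; split; first exact: exists_polarization hsetup.
move=> mu muR muA mu_linl mu_linr; split; first exact: setup_original.
move=> Q; have lQ : is_loop Q := setup_is_loop hsetup muR mu_linl mu_linr.
have Q3 : upper_center Q 3 = setT := upper_center3 hsetup muR muA mu_linl mu_linr.
split=> //.
- split; apply: nilpotency_class_leE; last exact: Q3.
  exact: group_class3 hsetup.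
- exact: (setup_Inn_abelian hsetup muR muA mu_linl mu_linr).
- have Q2 := upper_center2P hsetup muR muA mu_linl mu_linr.
  rewrite (nilpotency_classSE lQ Q3) Q2.
  split=> [/existsNP[x /existsNP[y /existsNP[z E]]] | [x [y [z E]]] H].
    by exists x, y, z.
  exact/E/H.
Qed.
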